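(* Let $\mu_1,\mu_2,\mu_3$ be three mass distributions in $\mathbb{R}^2$ and let $\ell$ be any line in the plane. Then there exist two lines $\ell_1,\ell_2$ (where a line at infinity is allowed) such that $\{\ell_1,\ell_2\}$ simultaneously bisects $\mu_1,\mu_2,\mu_3$ and $\ell_1$ is parallel to $\ell$.
   Context: A mass distribution $\mu$ on $\mathbb{R}^2$ is a measure such that all open subsets are measurable, $0<\mu(\mathbb{R}^2)<\infty$, and $\mu(S)=0$ for every lower-dimensional subset $S$. For a finite set $\mathcal{L}$ of oriented lines, each $\ell'\in\mathcal{L}$ has positive side $\ell'^+=\{x: g(x)\ge 0\}$ for a defining affine function $g(x)=a_1x_1+a_2x_2+a_0$; lines at infinity ($g\equiv a_0\neq 0$ constant) are allowed, with $\ell'^+=\mathbb{R}^2$, $\ell'^-=\emptyset$. Let $\lambda(p)$ be the number of lines of $\mathcal{L}$ having $p$ on their positive side, $R^+=\{p:\lambda(p)\text{ even}\}$, $R^-=\{p:\lambda(p)\text{ odd}\}$. $\mathcal{L}$ simultaneously bisects $\mu_1,\dots,\mu_k$ if $\mu_i(R^+)=\mu_i(R^-)$ for all $i$; an unoriented set of lines bisects if some orientation does. A line at infinity is considered parallel to every line. *)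

(* Defs.v *)
From HB Require Import structures.
From mathcomp Require Import all_boot all_order all_algebra.
From mathcomp Require Import all_classical all_reals all_analysis.
Set Implicit Arguments. Unset Strict Implicit. Unset Printing Implicit Defensive.
Import Order.TTheory GRing.Theory Num.Theory.
Import numFieldNormedType.Exports.
Local Open Scope classical_set_scope.
Local Open Scope ring_scope.

(* An oriented line, given by its defining affine function
   g(x) = a1 * x1 + a2 * x2 + a0, with (a1,a2,a0) <> (0,0,0).
   If a1 = a2 = 0 (and a0 <> 0) it is a line at infinity. *)
Record oline (R : realType) := OLine { la1 : R; la2 : R; la0 : R }.

Definition affg (R : realType) (l : oline R) (x : R * R) : R :=
  la1 l * x.1 + la2 l * x.2 + la0 l.

Definition valid_line (R : realType) (l : oline R) : Prop :=
  [/\ la1 l = 0, la2 l = 0 & la0 l = 0] -> False.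

Definition proper_line (R : realType) (l : oline R) : Prop :=
  ~ (la1 l = 0 /\ la2 l = 0).

Definition pos_side (R : realType) (l : oline R) : set (R * R) :=
  [set x | 0 <= affg l x].

Definition line_pts (R : realType) (l : oline R) : set (R * R) :=
  [set x | affg l x = 0].

(* parallelism; a line at infinity is parallel to every line *)
Definition parallel (R : realType) (l l' : oline R) : Prop :=
  la1 l * la2 l' - la2 l * la1 l' = 0.

Definition lambda (R : realType) (L : seq (oline R)) (p : R * R) : nat :=
  count (fun l => `[< pos_side l p >]) L.

Definition Rplus (R : realType) (L : seq (oline R)) : set (R * R) :=
  [set p | ~~ odd (lambda L p)].
Definition Rminus (R : realType) (L : seq (oline R)) : set (R * R) :=
  [set p | odd (lambda L p)].

Definition mass_distribution (R : realType)
    (mu : {measure set (R * R)%type -> \bar R}) : Prop :=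
  [/\ (forall A : set (R * R), open A -> measurable A),
      (0 < mu setT)%E, (mu setT < +oo)%E &
      (forall S : set (R * R), measurable S ->
         (exists l : oline R, proper_line l /\ S `<=` line_pts l) ->
         mu S = 0%E)].

Definition bisects (R : realType) (L : seq (oline R))
    (mu : {measure set (R * R)%type -> \bar R}) : Prop :=
  mu (Rplus L) = mu (Rminus L).

(* Main.v *)
Require Import Defs.
From Stdlib Require Import Ring.
From HB Require Import structures.
From mathcomp Require Import all_boot all_order all_algebra.
From mathcomp Require Import all_classical all_reals all_analysis.
From mathcomp Require Import measurable_realfun lra.
Set Implicit Arguments. Unset Strict Implicit. Unset Printing Implicit Defensive.
Import Order.TTheory GRing.Theory Num.Theory.
Import numFieldNormedType.Exports.
Local Open Scope classical_set_scope.

(* The parallels of [l], oriented and completed by the line at infinity, form a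
   circle, and all oriented lines form a sphere. The discrepancies
   [mu_i(R-) - mu_i(R+)] define a continuous map [S^1 x S^2 -> R^3] which is odd
   in each factor, because mass distributions do not charge lines. Such a map has
   a zero: on a fundamental domain, the cube [[-1, 1]^3], the values of a zero-free
   map at the nodes of a fine grid would be labelled by sign and index of a
   dominant coordinate, with no opposite labels on neighbouring nodes; counting
   alternating simplices modulo 2, as in Fan's proof of Tucker's lemma, rules this
   out. *)

(** * Alternating simplices modulo 2 *)

(** Counts modulo 2 are booleans under exclusive or. Seen as the field with two elements, they let
    [ring] cancel every term that occurs twice. *)
Lemma addb_ring_theory : ring_theory false true addb andb addb id eq.
Proof. by split; do !case. Qed.
Lemma bool_eqbP (x y : bool) : (x == y) = true -> x = y.
Proof. exact: eqP. Qed.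
Ltac bool_constant t :=
  match t with true => constr:(true) | false => constr:(false)
  | _ => constr:(InitialRing.NotConstant) end.
Add Ring addb_ring : addb_ring_theory
  (decidable bool_eqbP, constants [bool_constant]).

Definition label := (bool * 'I_3)%type.

Definition opp_label (a : label) : label := (~~ a.1, a.2).

(** Tucker's condition on an edge: its ends share no index with opposite signs. Compatible labels
    with the same index are equal. *)
Definition compatible (a b : label) := b != opp_label a.

(* [alt1 s] and [alt2 s] recognise the alternating edges and triangles of Fan's
   lemma: the indices are distinct, the signs alternate when the indices are put
   in increasing order, and the least index has sign [s]. *)
Definition alt1 (s : bool) (a b : label) : bool :=
  (a.1 != b.1) && (if a.2 < b.2 then a.1 == s else (b.2 < a.2) && (b.1 == s)).

Definition alt2 (s : bool) (a b c : label) : bool :=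
  let vertex i := has (fun l : label => l == (s (+) odd i, inord i)) [:: a; b; c] in
  [&& vertex 0, vertex 1 & vertex 2].

(** A sign change between compatible labels forces distinct indices, so the edge is alternating for
    exactly one leading sign. *)
Lemma alt1_boundary a b : compatible a b ->
  alt1 true a b (+) alt1 false a b = a.1 (+) b.1.
Proof. by case: a b => [[] [[|[|[|//]]] ?]] [[] [[|[|[|//]]] ?]]. Qed.

(** If two labels coincide, the two edges to the third cancel. With three distinct indices, the
    number of positively led alternating edges is odd exactly when the signs alternate. *)
Lemma alt2_boundary a b c : compatible a b -> compatible a c -> compatible b c ->
  alt2 true a b c (+) alt2 false a b c =
  alt1 true a b (+) alt1 true b c (+) alt1 true a c.
Proof.
case: a b c => [a i] [b j] [c k].
rewrite /alt2 /compatible /opp_label /= !xpair_eqE -!val_eqE /= !inordK //.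
by case: a i b j c k => [] [[|[|[|//]]] ?] [] [[|[|[|//]]] ?] [] [[|[|[|//]]] ?].
Qed.

(** Only three indices exist, so two of the four labels coincide. The faces containing both are not
    alternating, and the other two faces are equal. *)
Lemma alt2_cocycle s a b c d :
  compatible a b -> compatible a c -> compatible a d -> compatible b c ->
  compatible b d -> compatible c d ->
  alt2 s a b c (+) alt2 s a b d (+) alt2 s a c d (+) alt2 s b c d = false.
Proof.
case: a b c d => [a i] [b j] [c k] [d l].
rewrite /alt2 /compatible /opp_label /= !xpair_eqE -!val_eqE /= !inordK //.
case: a i b j => [] [[|[|[|//]]] ?] [] [[|[|[|//]]] ?] //=;
case: c k => [] [[|[|[|//]]] ?] //=;
case: d l => [] [[|[|[|//]]] ?] //=; by case: s.
Qed.

Lemma alt1C s a b : alt1 s a b = alt1 s b a.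
Proof. by case: s a b => [] [[] [[|[|[|//]]] ?]] [[] [[|[|[|//]]] ?]]. Qed.

Lemma alt2C s a b c : alt2 s a b c = alt2 s b a c.
Proof. by rewrite /alt2 /= !orbF !(orbCA (a == _)). Qed.

Lemma alt2CA s a b c : alt2 s a b c = alt2 s a c b.
Proof. by rewrite /alt2 /= !orbF !(orbC (c == _)). Qed.

Lemma alt1N s a b : alt1 s (opp_label a) (opp_label b) = alt1 (~~ s) a b.
Proof. by case: s a b => [] [[] [[|[|[|//]]] ?]] [[] [[|[|[|//]]] ?]]. Qed.

Lemma alt2N s a b c :
  alt2 s (opp_label a) (opp_label b) (opp_label c) = alt2 (~~ s) a b c.
Proof.
case: a b c => [a i] [b j] [c k]; rewrite /alt2 /= !xpair_eqE.
by case: s a b c => [] [] [] [].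
Qed.

(** The corners are in cyclic order, and the square is cut along the diagonal from [a] to [c]. *)
Definition square s a b c d : bool := alt2 s a b c (+) alt2 s a d c.

Lemma square_boundary a b c d : compatible a b -> compatible a c ->
  compatible a d -> compatible b c -> compatible d c ->
  square true a b c d (+) square false a b c d =
  alt1 true a b (+) alt1 true b c (+) alt1 true d c (+) alt1 true a d.
Proof.
move=> ab ac ad bc dc; rewrite /square.
transitivity ((alt2 true a b c (+) alt2 false a b c) (+)
  (alt2 true a d c (+) alt2 false a d c)); first by ring.
rewrite !alt2_boundary //; ring.
Qed.

(* The value of a square does not depend on the diagonal. *)
Lemma square_flip s a b c d :
  compatible a b -> compatible a c -> compatible a d -> compatible b c ->
  compatible b d -> compatible c d ->
  square s d c b a = square s a b c d.
Proof.
move=> ab ac ad bc bd cd; have := alt2_cocycle s ab ac ad bc bd cd.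
rewrite /square (alt2C s d c b) (alt2CA s c d b) (alt2C s c b d).
rewrite (alt2C s d a b) (alt2CA s a d b) (alt2CA s a d c).
by do 4!case: alt2.
Qed.

Lemma squareN s a b c d :
  square s (opp_label a) (opp_label b) (opp_label c) (opp_label d) =
  square (~~ s) a b c d.
Proof. by rewrite /square !alt2N. Qed.

(* Coning off at a vertex makes [alt2] a coboundary on the cube, so the faces cancel. *)
Lemma cube_boundary s (L : bool -> bool -> bool -> label) :
  (forall i j k i' j' k', compatible (L i j k) (L i' j' k')) ->
  let q := square s in
  q (L false false false) (L false true false) (L false true true) (L false false true) (+)
  q (L true false false) (L true true false) (L true true true) (L true false true) (+)
  q (L false false false) (L true false false) (L true false true) (L false false true) (+)
  q (L false true false) (L true true false) (L true true true) (L false true true) (+)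
  q (L false false false) (L true false false) (L true true false) (L false true false) (+)
  q (L false false true) (L true false true) (L true true true) (L false true true) = false.
Proof.
move=> cL q; rewrite {}/q.
(* The apex is a corner, hidden behind an opaque [v] so that rewriting with [cone] leaves the coned
   terms alone. *)
have [v cv] : exists v, forall i j k, compatible v (L i j k).
  by exists (L false false false).
have cone i j k i' j' k' i'' j'' k'' :
  alt2 s (L i j k) (L i' j' k') (L i'' j'' k'') =
  alt2 s v (L i j k) (L i' j' k') (+) alt2 s v (L i j k) (L i'' j'' k'') (+)
  alt2 s v (L i' j' k') (L i'' j'' k'').
  have := @alt2_cocycle s v (L i j k) (L i' j' k') (L i'' j'' k'').
  by rewrite !cv !cL => /(_ isT isT isT isT isT isT); do 4!case: alt2.
by rewrite /square !cone; ring.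
Qed.

(** * Sums over paths, grids and boxes *)

Definition edge_sum s n (g : nat -> label) : bool :=
  \big[addb/false]_(i < n) alt1 s (g i) (g i.+1).

Definition square_sum s m n (F : nat -> nat -> label) : bool :=
  \big[addb/false]_(i < m) \big[addb/false]_(j < n)
    square s (F i j) (F i.+1 j) (F i.+1 j.+1) (F i j.+1).

Lemma addb_telescope n (u : nat -> bool) :
  \big[addb/false]_(i < n) (u i (+) u i.+1) = u 0 (+) u n.
Proof.
elim: n => [|n IH]; first by rewrite big_ord0 addbb.
by rewrite big_ord_recr /= IH; ring.
Qed.

(** Alternating edges of either leading sign are the sign changes along the path, and their parity
    depends only on the two ends. *)
Lemma edge_sum_boundary n g : (forall i, i < n -> compatible (g i) (g i.+1)) ->
  edge_sum true n g (+) edge_sum false n g = (g 0).1 (+) (g n).1.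
Proof.
move=> cg; rewrite /edge_sum -big_split /= -(addb_telescope n (fun i => (g i).1)).
by apply: eq_bigr => i _; rewrite alt1_boundary // cg.
Qed.

Lemma eq_edge_sum s n g h : (forall i, i <= n -> g i = h i) ->
  edge_sum s n g = edge_sum s n h.
Proof. by move=> gh; apply: eq_bigr => i _; rewrite !gh // ltnW. Qed.

Lemma edge_sumN s n g :
  edge_sum s n (fun i => opp_label (g i)) = edge_sum (~~ s) n g.
Proof. by apply: eq_bigr => i _; rewrite alt1N. Qed.

Lemma edge_sum_rev s n g : edge_sum s n (fun i => g (n - i)) = edge_sum s n g.
Proof.
rewrite /edge_sum (reindex_inj rev_ord_inj); apply: eq_bigr => i _ /=.
by rewrite subKn // subnSK // alt1C subKn // ltnW.
Qed.

Definition adjacent (i j : nat) := (i <= j.+1) && (j <= i.+1).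

Lemma adjacent_refl i : adjacent i i.
Proof. by rewrite /adjacent leqnSn. Qed.

Lemma adjacentS i : adjacent i i.+1.
Proof. by rewrite /adjacent leqnn (leq_trans (leqnSn i)). Qed.

Lemma adjacent_sym i j : adjacent i j = adjacent j i.
Proof. by rewrite /adjacent andbC. Qed.

(** Diagonal neighbours are included, so that a square may be cut along either diagonal. *)
Definition grid_compatible m n (F : nat -> nat -> label) :=
  forall i j i' j', i <= m -> i' <= m -> j <= n -> j' <= n ->
    adjacent i i' -> adjacent j j' -> compatible (F i j) (F i' j').

(** An interior edge of the grid bounds two squares and cancels: the sum telescopes first along [j],
    then along [i]. *)
Lemma square_sum_boundary m n F : grid_compatible m n F ->
  square_sum true m n F (+) square_sum false m n F =
  edge_sum true n (F 0) (+) edge_sum true n (F m) (+)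
  edge_sum true m (F^~ 0) (+) edge_sum true m (F^~ n).
Proof.
move=> cF; rewrite /square_sum -big_split /=.
transitivity (\big[addb/false]_(i < m)
   ((edge_sum true n (F i) (+) edge_sum true n (F i.+1)) (+)
   (alt1 true (F i 0) (F i.+1 0) (+) alt1 true (F i n) (F i.+1 n)))).
  apply: eq_bigr => i _.
  rewrite -(addb_telescope n (fun j => alt1 true (F i j) (F i.+1 j))).
  rewrite /edge_sum -!big_split /=; apply: eq_bigr => j _.
  rewrite square_boundary; [by ring|..]; apply: cF;
    by rewrite ?(ltnW (ltn_ord _)) ?adjacent_refl ?adjacentS // adjacent_sym adjacentS.
rewrite big_split /= (addb_telescope m (fun i => edge_sum true n (F i))).
by rewrite big_split addbA.
Qed.

Lemma eq_square_sum s m n F G :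
  (forall i j, i <= m -> j <= n -> F i j = G i j) ->
  square_sum s m n F = square_sum s m n G.
Proof.
move=> FG; apply: eq_bigr => i _; apply: eq_bigr => j _.
by rewrite !FG // ltnW.
Qed.

Lemma square_sumN s m n F :
  square_sum s m n (fun i j => opp_label (F i j)) = square_sum (~~ s) m n F.
Proof. by apply: eq_bigr => i _; apply: eq_bigr => j _; rewrite squareN. Qed.

(** A reflection cuts every square along its other diagonal, which [square_flip] allows. *)
Lemma square_sum_rev s m n F : grid_compatible m n F ->
  square_sum s m n (fun i j => F i (n - j)) = square_sum s m n F.
Proof.
move=> cF; apply: eq_bigr => i _.
rewrite (reindex_inj rev_ord_inj); apply: eq_bigr => j _ /=.
have -> : (n - (n - j.+1).+1) = j by rewrite subnSK // subKn // ltnW.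
rewrite (subKn (ltn_ord j)) square_flip; first reflexivity.
all: apply: cF; rewrite ?(ltnW (ltn_ord _)) ?adjacent_refl ?adjacentS //.
all: by rewrite adjacent_sym adjacentS.
Qed.

(** Stokes modulo 2: a face between two unit cubes cancels, leaving the six sides of the box. *)
Lemma cube_sum_boundary s m n p (L : nat -> nat -> nat -> label) :
  (forall i j k i' j' k', i <= m -> i' <= m -> j <= n -> j' <= n ->
     k <= p -> k' <= p -> adjacent i i' -> adjacent j j' -> adjacent k k' ->
     compatible (L i j k) (L i' j' k')) ->
  (square_sum s n p (L 0) (+) square_sum s n p (L m)) (+)
  (square_sum s m p (fun i k => L i 0 k) (+)
   square_sum s m p (fun i k => L i n k)) (+)
  (square_sum s m n (fun i j => L i j 0) (+)
   square_sum s m n (fun i j => L i j p)) = false.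
Proof.
move=> cL.
(* Unit faces orthogonal to the first, second and third axis. *)
pose X i j k := square s (L i j k) (L i j.+1 k) (L i j.+1 k.+1) (L i j k.+1).
pose Y i j k := square s (L i j k) (L i.+1 j k) (L i.+1 j k.+1) (L i j k.+1).
pose Z i j k := square s (L i j k) (L i.+1 j k) (L i.+1 j.+1 k) (L i j.+1 k).
have cube i j k : i < m -> j < n -> k < p ->
  (X i j k (+) X i.+1 j k) (+) (Y i j k (+) Y i j.+1 k) (+)
  (Z i j k (+) Z i j k.+1) = false.
  (* The booleans [a], [b], [c] are coerced to offsets 0 and 1 from the corner [(i, j, k)]. *)
  move=> im jn kp; have := @cube_boundary s (fun a b c => L (a + i) (b + j) (c + k)).
  rewrite /X /Y /Z /= !add1n !add0n => <-; first by ring.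
  have bnd (a : bool) u v : u < v -> a + u <= v by case: a => // /ltnW.
  have nb (a b : bool) u : adjacent (a + u) (b + u).
    by case: a b => [] []; rewrite ?adjacent_refl ?adjacentS // adjacent_sym adjacentS.
  by move=> *; apply: cL; rewrite ?bnd ?nb.
have sumX : square_sum s n p (L 0) (+) square_sum s n p (L m) =
  \big[addb/false]_(i < m) \big[addb/false]_(j < n) \big[addb/false]_(k < p)
    (X i j k (+) X i.+1 j k).
  rewrite -(addb_telescope m (fun i => square_sum s n p (L i))).
  apply: eq_bigr => i _; rewrite -big_split; apply: eq_bigr => j _.
  by rewrite -big_split.
have sumY : square_sum s m p (fun i k => L i 0 k) (+)
    square_sum s m p (fun i k => L i n k) =
  \big[addb/false]_(i < m) \big[addb/false]_(j < n) \big[addb/false]_(k < p)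
    (Y i j k (+) Y i j.+1 k).
  rewrite -big_split; apply: eq_bigr => i _.
  apply: etrans (esym (addb_telescope n
    (fun j => \big[addb/false]_(k < p) Y i j k))) _.
  by apply: eq_bigr => j _; rewrite -big_split.
have sumZ : square_sum s m n (fun i j => L i j 0) (+)
    square_sum s m n (fun i j => L i j p) =
  \big[addb/false]_(i < m) \big[addb/false]_(j < n) \big[addb/false]_(k < p)
    (Z i j k (+) Z i j k.+1).
  rewrite -big_split; apply: eq_bigr => i _; rewrite -big_split.
  apply: eq_bigr => j _.
  exact: (esym (addb_telescope p (fun k => Z i j k))).
rewrite sumX sumY sumZ -!big_split big1 // => i _.
rewrite -!big_split big1 // => j _; rewrite -!big_split big1 // => k _.
exact: cube.
Qed.

(* The parity of the count is the coefficient of [x y^2] in [(x + y)^3], the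
   top class of [RP^1 x RP^2]. *)
Lemma no_compatible_odd_labeling n (L : nat -> nat -> nat -> label) :
  (forall i j k i' j' k', i <= n -> i' <= n -> j <= n -> j' <= n ->
     k <= n -> k' <= n -> adjacent i i' -> adjacent j j' -> adjacent k k' ->
     compatible (L i j k) (L i' j' k')) ->
  (forall j k, j <= n -> k <= n -> L n j k = opp_label (L 0 j k)) ->
  (forall i k, i <= n -> k <= n -> L i n k = opp_label (L i 0 (n - k))) ->
  (forall i j, i <= n -> j <= n -> L i j n = opp_label (L i (n - j) 0)) ->
  False.
Proof.
move=> cL Lx Ly Lz.
have cX i : i <= n -> grid_compatible n n (L i).
  by move=> le_in j k j' k' *; apply: cL => //; exact: adjacent_refl.
have cY j : j <= n -> grid_compatible n n (fun i k => L i j k).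
  by move=> le_jn i k i' k' *; apply: cL => //; exact: adjacent_refl.
have cZ k : k <= n -> grid_compatible n n (fun i j => L i j k).
  by move=> le_kn i j i' j' *; apply: cL => //; exact: adjacent_refl.
(* Opposite sides agree up to sign and reflection, so each pair counts the alternating triangles of
   both leading signs on a single side. *)
have := cube_sum_boundary true cL.
rewrite (eq_square_sum true Lx) square_sumN (eq_square_sum true Ly) square_sumN.
rewrite (square_sum_rev _ (cY 0 isT)) (eq_square_sum true Lz) square_sumN.
rewrite (square_sum_rev _ (cZ 0 isT)) /=.
(* These counts reduce to edges of the cube, which are again identified up to sign and reversal. *)
have := square_sum_boundary (cX 0 isT).
rewrite (@eq_edge_sum _ _ (L 0 n) _ (fun k => Ly 0 k isT)).
rewrite (@eq_edge_sum _ _ ((L 0)^~ n) _ (fun j => Lz 0 j isT)).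
rewrite !edge_sumN /= (edge_sum_rev _ _ (L 0 0)) (edge_sum_rev _ _ ((L 0)^~ 0)).
have := square_sum_boundary (cY 0 isT).
rewrite (@eq_edge_sum _ _ (fun k => L n 0 k) _ (fun k => Lx 0 k isT)) edge_sumN /=.
have := square_sum_boundary (cZ 0 isT).
rewrite (@eq_edge_sum _ _ (fun j => L n j 0) _ (fun j => Lx j 0 ^~ isT)) edge_sumN /=.
rewrite (@eq_edge_sum _ _ (fun i => L i n 0) _ (fun i => Ly i 0 ^~ isT)) edge_sumN /=.
rewrite subn0 => bZ bY bX total.
(* All other edges cancel in the total. The ends of this one carry opposite labels, so its sign
   changes an odd number of times and the total is [true]. *)
have := @edge_sum_boundary n (fun i => L i 0 n).
rewrite Lx //= => bC.
have : true = false; last by [].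
rewrite -[RHS]total.
transitivity (edge_sum true n (fun i => L i 0 n) (+)
  edge_sum false n (fun i => L i 0 n)).
  rewrite bC; first by case: (_.1).
  by move=> *; apply: cL; rewrite ?adjacent_refl ?adjacentS // ltnW.
rewrite bX bY bZ; change [eta L 0 0] with (L 0 0); ring.
Qed.

(** * Zeros of odd maps *)

Local Open Scope ring_scope.

Definition dominant_index (R : realType) (w : 'I_3 -> R) : 'I_3 :=
  [arg max_(i > ord0) `|w i|]%O.

Lemma dominant_indexP (R : realType) (w : 'I_3 -> R) i :
  `|w i| <= `|w (dominant_index w)|.
Proof. by rewrite /dominant_index; case: arg_maxP => // j _; exact. Qed.

Definition dominant_label (R : realType) (w : 'I_3 -> R) : label :=
  (0 <= w (dominant_index w), dominant_index w).

(** The index depends only on absolute values. A nonzero vector has a nonzero dominant coordinate,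
    so its sign really flips, although zero is labelled as positive. *)
Lemma dominant_labelN (R : realType) (w : 'I_3 -> R) i : w i != 0 ->
  dominant_label (\- w) = opp_label (dominant_label w).
Proof.
move=> wi0.
have E : dominant_index (\- w) = dominant_index w.
  rewrite /dominant_index; congr (Order.arg_max _ _ _).
  by apply/funext => j /=; rewrite normrN.
have := dominant_indexP w i; rewrite /dominant_label /opp_label /= E.
move=> le_w; congr pair; rewrite oppr_ge0 leNgt.
have : w (dominant_index w) != 0.
  by apply: contraNneq wi0 => w0; move: le_w; rewrite w0 normr0 normr_le0.
by case: ltgtP.
Qed.

(** Opposite labels give a common dominant index, where the two values have opposite signs and
    absolute values at least [c]. *)
Lemma dominant_label_gap (R : realType) (v w : 'I_3 -> R) c :
  ~~ compatible (dominant_label v) (dominant_label w) ->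
  (exists i, c <= `|v i|) -> (exists i, c <= `|w i|) -> 
  exists i, 2 * c <= `|v i - w i|.
Proof.
rewrite /compatible negbK /dominant_label /opp_label /= => /eqP[+ E].
rewrite E => sgn [i ci] [j cj]; exists (dominant_index v).
have := le_trans ci (dominant_indexP v i).
have := le_trans cj (dominant_indexP w j).
rewrite E; move: (v _) (w _) sgn => x y.
case: (leP 0 x) => x0 /esym/=; case: (leP 0 y) => // y0 _ cy cx;
move: cy cx (ler_norm (x - y)) (ler_norm (- (x - y))); rewrite normrN.
  by rewrite (ger0_norm x0) (ltr0_norm y0); lra.
by rewrite (ltr0_norm x0) (ger0_norm y0); lra.
Qed.

Definition node (R : realType) (n i : nat) : R := 2 * (i%:R / n%:R) - 1.

Lemma node0 (R : realType) n : node R n 0 = -1.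
Proof. by rewrite /node mul0r mulr0 sub0r. Qed.

Lemma nodeN (R : realType) n i : (0 < n)%N -> (i <= n)%N ->
  node R n (n - i) = - node R n i.
Proof.
move=> n0 le_in; rewrite /node natrB // mulrBl divff ?pnatr_eq0 -?lt0n //; lra.
Qed.

Lemma noden (R : realType) n : (0 < n)%N -> node R n n = 1.
Proof. by move=> n0; rewrite -{2}(subn0 n) nodeN // node0 opprK. Qed.

Lemma node_itv (R : realType) n i : (0 < n)%N -> (i <= n)%N -> node R n i \in `[-1, 1].
Proof.
move=> n0 le_in; rewrite in_itv /= /node.
have : 0 <= i%:R / n%:R :> R by rewrite divr_ge0.
have : i%:R / n%:R <= 1 :> R by rewrite ler_pdivrMr ?ltr0n // mul1r ler_nat.
by move: (_ / _) => x; lra.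
Qed.

Lemma node_adjacent (R : realType) n i j : adjacent i j ->
  `|node R n i - node R n j| <= 2 / n%:R.
Proof.
move=> /andP[ij ji].
have -> : node R n i - node R n j = 2 / n%:R * (i%:R - j%:R).
  by rewrite /node; move: (n%:R^-1) => m; lra.
rewrite normrM ger0_norm ?divr_ge0 // ler_piMr ?divr_ge0 // ler_norml.
by move: ij ji; rewrite -!(ler_nat R) -!natr1; lra.
Qed.

(** The interval stands for a half circle and the square for a hemisphere; the last two hypotheses
    express oddness on their boundaries. Without a zero, opposite labels would occur at arbitrarily
    close nodes, against continuity at a cluster point. *)
Lemma odd_cube_zero (R : realType) (f : 'I_3 -> R * R * R -> R) :
  (forall i, continuous (f i)) ->
  (forall i x y, f i (1, x, y) = - f i (-1, x, y)) ->
  (forall i t x y, Num.max `|x| `|y| = 1 -> f i (t, - x, - y) = - f i (t, x, y)) ->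
  exists p, forall i, f i p = 0.
Proof.
move=> cf ft fxy; apply: contrapT => nz.
have {}nz p : exists i, f i p != 0.
  apply: contrapT => fp0; apply: nz; exists p => i; apply: contrapT => /eqP fi.
  by apply: fp0; exists i.
pose lab p := dominant_label (f^~ p).
have labN p q : (forall i, f i q = - f i p) -> lab q = opp_label (lab p).
  move=> fqp; have [i fi] := nz p; rewrite -(dominant_labelN fi); congr dominant_label.
  by apply/funext => j /=; exact: fqp.
pose box : set (R * R * R) :=
  `[-1, 1]%classic `*` `[-1, 1]%classic `*` `[-1, 1]%classic.
(* Balls are open and neighbouring nodes may be [2 / n.+1] apart in a coordinate, hence the
   numerator 3. *)
have step n : exists pq : (R * R * R) * (R * R * R),
  [/\ box pq.1, ball pq.1 (3 / n.+1%:R) pq.2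
    & ~~ compatible (lab pq.1) (lab pq.2)].
  apply: contrapT => none.
  pose pt i j k := (node R n.+1 i, node R n.+1 j, node R n.+1 k).
  apply: (@no_compatible_odd_labeling n.+1 (fun i j k => lab (pt i j k))).
  - move=> i j k i' j' k' hi hi' hj hj' hk hk' ii jj kk.
    apply: contrapT => /negP nc; apply: none; exists (pt i j k, pt i' j' k').
    have adjacent_lt a b : adjacent a b ->
        `|node R n.+1 a - node R n.+1 b| < 3 / n.+1%:R.
      move=> /node_adjacent /le_lt_trans; apply.
      by rewrite ltr_pM2r ?invr_gt0 ?ltr0n //; lra.
    split => //=; first by split; [split|]; exact: node_itv.
    by split; [split|]; exact: adjacent_lt.
  - by move=> j k hj hk; apply: labN => m; rewrite /pt noden // node0 ft.
  - move=> i k hi hk; apply: labN => m.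
    rewrite /pt noden // node0 nodeN // -fxy ?opprK //.
    rewrite normrN1 normrN max_l // ler_norml.
    by have := @node_itv R n.+1 k isT hk; rewrite in_itv.
  - move=> i k hi hk; apply: labN => m.
    rewrite /pt noden // node0 nodeN // -fxy ?opprK //.
    rewrite normrN1 normrN max_r // ler_norml.
    by have := @node_itv R n.+1 k isT hk; rewrite in_itv.
have [s hs] := choice step.
have cbox : compact box by do 2?apply: compact_setX; exact: segment_compact.
have [|p [_ cl]] := cbox ((fun n => (s n).1) @ \oo) _.
  by exists 0%N => // n _ /=; have [] := hs n.
(* Near [p] the coordinate [m0] keeps absolute value at least [3c/4], while every coordinate varies
   by less than [c/2] between two points. *)
have [m0 fm0] := nz p; set c := `|f m0 p|.
have c0 : 0 < c by rewrite normr_gt0.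
have : \forall q \near p, forall i, `|f i p - f i q| < c / 4.
  apply: (@filter_forall _ _ (fun i q => `|f i p - f i q| < c / 4) (nbhs p)) => i.
  by move/cvgrPdist_lt : (cf i p); apply; lra.
case/nbhs_ballP => r /= r0 hr.
(* Beyond [N], [3 / n.+1 < r / 2]; a first node within [r / 2] of [p] then brings its partner within
   [r]. *)
have r6 : 0 < r / 6 by lra.
have [N _ hN] := near_infty_natSinv_lt (PosNum r6).
have [||_ [[n /= Nn <-] pn]] :=
    cl ((fun n => (s n).1) @` [set n | (N <= n)%N]) (ball p (r / 2)).
- by exists N => // n Nn; exists n.
- by apply: nbhsx_ballx; lra.
have [_ snn inc] := hs n.
have pn' : ball p r (s n).1 by apply: le_ball pn; lra.
have qn : ball p r (s n).2.
  have -> : r = r / 2 + r / 2 by lra.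
  apply: ball_triangle pn _; apply: le_ball snn.
  by have /= := hN _ Nn; move: (_^-1) => x; lra.
have big q : ball p r q -> exists i, c * (3 / 4) <= `|f i q|.
  move=> /hr/(_ m0) h; exists m0.
  have := ler_normD (f m0 p - f m0 q) (f m0 q); rewrite subrK -/c; lra.
(* Opposite labels force a gap of at least [3c/2], contradicting the variation below [c/2]. *)
have [i] := dominant_label_gap inc (big _ pn') (big _ qn).
have := hr _ pn' i; have := hr _ qn i.
rewrite [X in _ <= X]distrC.
have := ler_distD (f i p) (f i (s n).2) (f i (s n).1).
rewrite (distrC (f i (s n).2) (f i p)); lra.
Qed.

(** * Discrepancy of a pair of lines *)

Lemma measurable_affg (R : realType) (l : oline R) : measurable_fun setT (affg l).
Proof.
by apply: measurable_funD => //; apply: measurable_funD; apply: measurable_funM.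
Qed.

Lemma measurable_pos_side (R : realType) (l : oline R) : measurable (pos_side l).
Proof.
have -> : pos_side l = affg l @^-1` `[0, +oo[%classic.
  by apply/seteqP; split => x /=; rewrite in_itv /= andbT.
by rewrite -[X in measurable X]setTI; apply: measurable_affg.
Qed.

Lemma measurable_line_pts (R : realType) (l : oline R) : measurable (line_pts l).
Proof.
have -> : line_pts l = affg l @^-1` [set 0] by [].
by rewrite -[X in measurable X]setTI; apply: measurable_affg.
Qed.

Lemma RminusE (R : realType) (l1 l2 : oline R) :
  Rminus [:: l1; l2] =
  (pos_side l1 `\` pos_side l2) `|` (pos_side l2 `\` pos_side l1).
Proof.
apply/seteqP; split => p; rewrite /Rminus /lambda /= addn0;
  case: asboolP => [h1|h1]; case: asboolP => [h2|h2] //=; tauto.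
Qed.

Lemma RplusE (R : realType) (L : seq (oline R)) : Rplus L = ~` Rminus L.
Proof. by apply/seteqP; split => p; rewrite /Rplus /Rminus /= => /negP. Qed.

Lemma measurable_Rminus (R : realType) (l1 l2 : oline R) :
  measurable (Rminus [:: l1; l2]).
Proof.
by rewrite RminusE; apply: measurableU; apply: measurableD; exact: measurable_pos_side.
Qed.

Lemma measurable_Rplus (R : realType) (l1 l2 : oline R) :
  measurable (Rplus [:: l1; l2]).
Proof. by rewrite RplusE; apply: measurableC; exact: measurable_Rminus. Qed.

Lemma mass_fin_num (R : realType) (mu : {measure set (R * R)%type -> \bar R}) A :
  mass_distribution mu -> measurable A -> mu A \is a fin_num.
Proof.
move=> [_ _ fin _] mA; rewrite ge0_fin_numE //; apply: le_lt_trans fin.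
by apply: le_measure; rewrite ?inE.
Qed.

(** Each of [A] and [B] lies in the union of the other with [N]. A null [N] gives oddness, a thin
    band gives continuity. *)
Lemma mass_dist_le (R : realType) (mu : {measure set (R * R)%type -> \bar R}) A B N :
  mass_distribution mu -> measurable A -> measurable B -> measurable N ->
  (forall x, ~ N x -> A x <-> B x) ->
  `|fine (mu A) - fine (mu B)| <= fine (mu N).
Proof.
move=> mmu mA mB mN AB.
have half C D : measurable C -> measurable D -> C `<=` D `|` N ->
    fine (mu C) <= fine (mu D) + fine (mu N).
  move=> mC mD CDN; rewrite -fineD ?mass_fin_num // fine_le ?mass_fin_num //.
    by rewrite fin_numD !mass_fin_num.
  apply: (@le_trans _ _ (mu (D `|` N))); last exact: measureU2.
  by apply: le_measure; rewrite ?inE //; exact: measurableU.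
rewrite ler_norml; apply/andP; split.
  suff : fine (mu B) <= fine (mu A) + fine (mu N) by lra.
  apply: half => // x Bx; have [Nx|/AB[_ /(_ Bx)]] := pselect (N x); [by right|by left].
suff : fine (mu A) <= fine (mu B) + fine (mu N) by lra.
apply: half => // x Ax; have [Nx|/AB[/(_ Ax)]] := pselect (N x); [by right|by left].
Qed.

Definition discrepancy (R : realType) (mu : {measure set (R * R)%type -> \bar R})
    (l1 l2 : oline R) : R :=
  fine (mu (Rminus [:: l1; l2])) - fine (mu (Rplus [:: l1; l2])).

Lemma discrepancy0_bisects (R : realType)
    (mu : {measure set (R * R)%type -> \bar R}) (l1 l2 : oline R) :
  mass_distribution mu -> discrepancy mu l1 l2 = 0 -> bisects [:: l1; l2] mu.
Proof.
move=> mmu /subr0_eq E; have fm := mass_fin_num mmu (measurable_Rminus l1 l2).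
have fp := mass_fin_num mmu (measurable_Rplus l1 l2).
by rewrite /bisects -(fineK fp) -(fineK fm) E.
Qed.

Lemma discrepancyC (R : realType) (mu : {measure set (R * R)%type -> \bar R})
    (l1 l2 : oline R) : discrepancy mu l1 l2 = discrepancy mu l2 l1.
Proof. by rewrite /discrepancy !RplusE !RminusE setUC. Qed.

Lemma line_pts_null (R : realType) (mu : {measure set (R * R)%type -> \bar R})
    (l : oline R) : mass_distribution mu -> valid_line l -> mu (line_pts l) = 0%E.
Proof.
move=> [_ _ _ null] vl; have [pl|/contrapT[l1 l2]] := pselect (proper_line l).
  by apply: null; [exact: measurable_line_pts|exists l; split].
suff -> : line_pts l = set0 by rewrite measure0.
apply/seteqP; split => // x; rewrite /line_pts /affg /= l1 l2 !mul0r !add0r => l0.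
exact: vl.
Qed.

Definition opp_line (R : realType) (l : oline R) : oline R :=
  OLine (- la1 l) (- la2 l) (- la0 l).

Lemma affgN (R : realType) (l : oline R) x : affg (opp_line l) x = - affg l x.
Proof. by rewrite /affg /= !mulNr -!opprD. Qed.

Lemma pos_sideN (R : realType) (l : oline R) x :
  ~ line_pts l x -> pos_side (opp_line l) x <-> ~ pos_side l x.
Proof.
rewrite /pos_side /line_pts /= affgN oppr_ge0 => /eqP.
by case: ltgtP.
Qed.

(** Off [l1], reversing its orientation exchanges the two regions, and the points of [l1] have
    measure zero. *)
Lemma discrepancyN (R : realType) (mu : {measure set (R * R)%type -> \bar R})
    (l1 l2 : oline R) : mass_distribution mu -> valid_line l1 ->
  discrepancy mu (opp_line l1) l2 = - discrepancy mu l1 l2.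
Proof.
move=> mmu vl; have null := line_pts_null mmu vl.
have eqmu A B : measurable A -> measurable B ->
    (forall x, ~ line_pts l1 x -> A x <-> B x) -> fine (mu A) = fine (mu B).
  move=> mA mB AB; apply: subr0_eq; apply/eqP; rewrite -normr_le0.
  have := mass_dist_le mmu mA mB (measurable_line_pts l1) AB.
  by rewrite null.
rewrite /discrepancy opprB; congr (_ - _); apply: eqmu;
  try exact: measurable_Rminus; try exact: measurable_Rplus;
  move=> x /pos_sideN h; rewrite !RplusE !RminusE /setU /setD /setC /=;
  have := pselect (pos_side l1 x); have := pselect (pos_side l2 x); tauto.
Qed.

(** * Continuity of the discrepancy *)

Definition close_lines (R : realType) (r : R) (l l' : oline R) :=
  [/\ `|la1 l - la1 l'| <= r, `|la2 l - la2 l'| <= r & `|la0 l - la0 l'| <= r].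

(** Changing each coefficient by at most [r] moves [affg l x] by at most this bound, so only points
    of the band can change side. *)
Definition band (R : realType) (l : oline R) (r : R) : set (R * R) :=
  [set x | `|affg l x| <= r * (`|x.1| + `|x.2| + 1)].

Lemma measurable_band (R : realType) (l : oline R) r : measurable (band l r).
Proof.
pose F (x : R * R) := r * (`|x.1| + `|x.2| + 1) - `|affg l x|.
have -> : band l r = F @^-1` `[0, +oo[%classic.
  by apply/seteqP; split => x /=; rewrite in_itv /= andbT /F subr_ge0.
have mF : measurable_fun setT F.
  apply: measurable_funB.
    apply: measurable_funM => //; apply: measurable_funD => //.
    by apply: measurable_funD; apply: measurableT_comp.
  by apply: measurableT_comp => //; exact: measurable_affg.
by rewrite -[X in measurable X]setTI; apply: mF.
Qed.

Lemma pos_side_close (R : realType) (l l' : oline R) r x :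
  close_lines r l l' -> ~ band l r x -> pos_side l x <-> pos_side l' x.
Proof.
move=> [c1 c2 c0] /negP; rewrite -ltNge /pos_side /= => hb.
have : `|affg l x - affg l' x| <= r * (`|x.1| + `|x.2| + 1).
  have -> : affg l x - affg l' x =
     (la1 l - la1 l') * x.1 + (la2 l - la2 l') * x.2 + (la0 l - la0 l').
    by rewrite /affg; lra.
  rewrite 2!mulrDr mulr1; apply: le_trans (ler_normD _ _) _; apply: lerD => //.
  apply: le_trans (ler_normD _ _) _.
  by rewrite !normrM lerD // ler_wpM2r.
move: hb; move: (r * _) (affg l x) (affg l' x) => b g g' hb.
rewrite ler_norml => h; move: hb; case: (leP 0 g) => g0.
  by rewrite (ger0_norm g0) => ?; split => // _; lra.
by rewrite (ltr0_norm g0) => ?; split => //; lra.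
Qed.

(** As [r] decreases to 0 the bands shrink to the null set [line_pts l]; continuity from above
    applies because the mass is finite. *)
Lemma band_small (R : realType) (mu : {measure set (R * R)%type -> \bar R})
    (l : oline R) e : mass_distribution mu -> valid_line l -> 0 < e ->
  exists2 r, 0 < r & fine (mu (band l r)) < e.
Proof.
move=> mmu vl e0.
have lim : \bigcap_n band l n.+1%:R^-1 = line_pts l.
  apply/seteqP; split => x /=; last first.
    by move=> lx n _; rewrite /band /= lx normr0 mulr_ge0 // !addr_ge0.
  move=> bx; apply: contrapT => /eqP gx.
  set c := `|x.1| + `|x.2| + 1.
  have c0 : 0 < c by rewrite ltr_wpDl // addr_ge0.
  have gc : 0 < `|affg l x| / c by rewrite divr_gt0 // normr_gt0.
  have [N _ /(_ N (leqnn N)) /=] := near_infty_natSinv_lt (PosNum gc).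
  by rewrite ltr_pdivlMr // ltNge => /negP; apply; exact: bx.
have : mu (band l n.+1%:R^-1) @[n --> \oo] --> mu (\bigcap_n band l n.+1%:R^-1).
  apply: (@nonincreasing_cvg_mu _ _ _ mu (fun n => band l n.+1%:R^-1)).
  - by rewrite -ge0_fin_numE // mass_fin_num //; exact: measurable_band.
  - by move=> n; exact: measurable_band.
  - by rewrite lim; exact: measurable_line_pts.
  - move=> m n mn; apply/subsetPset => x; rewrite /band /= => /le_trans; apply.
    by rewrite ler_wpM2r ?addr_ge0 // lef_pV2 ?posrE ?ltr0n // ler_nat.
rewrite lim line_pts_null //.
move=> /fine_cvgP[_] /cvgrPdist_lt /(_ _ e0) [N _ /(_ N (leqnn N))] /=.
rewrite sub0r normrN => h; exists N.+1%:R^-1; first by rewrite invr_gt0 ltr0n.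
by apply: le_lt_trans h; exact: ler_norm.
Qed.

Lemma discrepancy_cvg (R : realType) (mu : {measure set (R * R)%type -> \bar R})
    (T : topologicalType) (p : T) (l1 l2 : T -> oline R) :
  mass_distribution mu -> valid_line (l1 p) -> valid_line (l2 p) ->
  (forall r, 0 < r -> \forall q \near p, close_lines r (l1 p) (l1 q)) ->
  (forall r, 0 < r -> \forall q \near p, close_lines r (l2 p) (l2 q)) ->
  discrepancy mu (l1 q) (l2 q) @[q --> p] --> discrepancy mu (l1 p) (l2 p).
Proof.
move=> mmu v1 v2 c1 c2; apply/cvgrPdist_lt => e e0.
(* Two bands of mass below [e / 4] change the measures of [Rminus] and [Rplus] by less than [e / 2]
   each. *)
have e4 : 0 < e / 4 by lra.
have [r1 r10 b1] := band_small mmu v1 e4.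
have [r2 r20 b2] := band_small mmu v2 e4.
near=> q.
have d1 : close_lines r1 (l1 p) (l1 q) by near: q; exact: c1.
have d2 : close_lines r2 (l2 p) (l2 q) by near: q; exact: c2.
set N1 := band _ _ in b1; set N2 := band _ _ in b2.
have mN1 : measurable N1 by exact: measurable_band.
have mN2 : measurable N2 by exact: measurable_band.
have mN : measurable (N1 `|` N2) by exact: measurableU.
have small : fine (mu (N1 `|` N2)) <= fine (mu N1) + fine (mu N2).
  rewrite -fineD ?mass_fin_num // fine_le ?mass_fin_num //.
    by rewrite fin_numD !mass_fin_num.
  exact: measureU2.
have same x : ~ (N1 `|` N2) x ->
    (pos_side (l1 p) x <-> pos_side (l1 q) x) /\
    (pos_side (l2 p) x <-> pos_side (l2 q) x).
  by move=> /not_orP[n1 n2]; split; [exact: pos_side_close n1|exact: pos_side_close n2].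
have : `|fine (mu (Rminus [:: l1 p; l2 p])) - fine (mu (Rminus [:: l1 q; l2 q]))|
    <= fine (mu (N1 `|` N2)).
  apply: mass_dist_le => //; try exact: measurable_Rminus.
  by move=> x /same[h1 h2]; rewrite !RminusE /setU /setD /=; tauto.
have : `|fine (mu (Rplus [:: l1 p; l2 p])) - fine (mu (Rplus [:: l1 q; l2 q]))|
    <= fine (mu (N1 `|` N2)).
  apply: mass_dist_le => //; try exact: measurable_Rplus.
  by move=> x /same[h1 h2]; rewrite !RplusE !RminusE /setU /setD /setC /=; tauto.
rewrite /discrepancy !ler_norml => hp hm; rewrite ltr_norml; lra.
Unshelve. all: by end_near. Qed.

Lemma near_close_lines (R : realType) (T : topologicalType) (p : T)
    (l : T -> oline R) :
  {for p, continuous (fun q => la1 (l q))} ->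
  {for p, continuous (fun q => la2 (l q))} ->
  {for p, continuous (fun q => la0 (l q))} ->
  forall r, 0 < r -> \forall q \near p, close_lines r (l p) (l q).
Proof.
move=> /cvgrPdist_le c1 /cvgrPdist_le c2 /cvgrPdist_le c0 r r0; near=> q.
by split; near: q; [exact: c1|exact: c2|exact: c0].
Unshelve. all: by end_near. Qed.

(* A path from the line at infinity to its opposite through all parallels of [l]. *)
Definition parallel_line (R : realType) (l : oline R) (t : R) : oline R :=
  OLine ((1 - `|t|) * la1 l) ((1 - `|t|) * la2 l) t.

Lemma parallel_line_valid (R : realType) (l : oline R) t :
  proper_line l -> valid_line (parallel_line l t).
Proof.
move=> pl [/= + + t0]; rewrite t0 normr0 subr0 !mul1r => l1 l2.
exact: pl.
Qed.

Lemma parallel_lineP (R : realType) (l : oline R) t :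
  parallel (parallel_line l t) l.
Proof. by rewrite /parallel /=; lra. Qed.

(* The square [-1, 1]^2 as a hemisphere of coefficient vectors: antipodal
   boundary points give opposite lines. *)
Definition square_line (R : realType) (x y : R) : oline R :=
  OLine x y (1 - Num.max `|x| `|y|).

Lemma square_line_valid (R : realType) (x y : R) : valid_line (square_line x y).
Proof.
by move=> [/= -> ->]; rewrite normr0 maxxx subr0 => /eqP; rewrite oner_eq0.
Qed.

Theorem theorem3 (R : realType)
    (mu1 mu2 mu3 : {measure set (R * R)%type -> \bar R})
    (l : oline R) :
  mass_distribution mu1 -> mass_distribution mu2 -> mass_distribution mu3 ->
  proper_line l ->
  exists l1 l2 : oline R,
    [/\ valid_line l1 /\ valid_line l2,
        bisects [:: l1; l2] mu1, bisects [:: l1; l2] mu2,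
        bisects [:: l1; l2] mu3 & parallel l1 l].
Proof.
move=> m1 m2 m3 pl.
pose mu (i : 'I_3) := nth mu1 [:: mu1; mu2; mu3] i.
have mmu i : mass_distribution (mu i) by case: i => [[|[|[|]]]].
pose f i (p : R * R * R) :=
  discrepancy (mu i) (parallel_line l p.1.1) (square_line p.1.2 p.2).
have fst_c (p : R * R * R) : {for p, continuous (fun q : R * R * R => q.1.1)}.
  by apply: (@cvg_comp _ _ _ fst fst); exact: cvg_fst.
have snd_c (p : R * R * R) : {for p, continuous (fun q : R * R * R => q.1.2)}.
  apply: (@cvg_comp _ _ _ fst snd); [exact: cvg_fst | exact: cvg_snd].
have thd_c (p : R * R * R) : {for p, continuous (fun q : R * R * R => q.2)}.
  exact: cvg_snd.
have [||i t x y xy|p fp] := @odd_cube_zero R f.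
- move=> i p; apply: discrepancy_cvg => //.
  + exact: parallel_line_valid.
  + exact: square_line_valid.
  + have c (a : R) : {for p, continuous (fun q : R * R * R => (1 - `|q.1.1|) * a)}.
      apply: cvgMl; apply: cvgB; first exact: cvg_cst.
      by apply: cvg_norm; exact: fst_c.
    apply: near_close_lines; [exact: c|exact: c|exact: fst_c].
  + apply: near_close_lines; [exact: snd_c|exact: thd_c|].
    apply: cvgB; first exact: cvg_cst.
    apply: (@continuous_max R _ (fun q : R * R * R => `|q.1.2|)
      (fun q : R * R * R => `|q.2|) p).
      by apply: cvg_norm; exact: snd_c.
    by apply: cvg_norm; exact: thd_c.
(* At [t = 1] and [t = -1] the first line is at infinity, with opposite orientations. *)
- move=> i x y; rewrite /f /= -discrepancyN //; last exact: parallel_line_valid.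
  congr discrepancy; rewrite /parallel_line /opp_line /=.
  by rewrite normrN normr1 subrr !mul0r oppr0 opprK.
(* On the boundary of the square the constant term vanishes, so antipodal points give opposite
   second lines; symmetry brings that line to the first slot. *)
- rewrite /f /= !(discrepancyC _ (parallel_line l t)) -discrepancyN //.
    congr discrepancy; rewrite /square_line /opp_line /=.
    by rewrite !normrN xy subrr oppr0.
  exact: square_line_valid.
(* Both families consist of valid lines for all real parameters, wherever the zero [p] lies. *)
exists (parallel_line l p.1.1), (square_line p.1.2 p.2).
have b i := discrepancy0_bisects (mmu i) (fp i).
split; first by split; [exact: parallel_line_valid|exact: square_line_valid].
- exact: (b (@Ordinal 3 0 isT)).
- exact: (b (@Ordinal 3 1 isT)).
- exact: (b (@Ordinal 3 2 isT)).
- exact: parallel_lineP.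
Qed.
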